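(* Let $N\in\mathbb{N}$ and $d, d', d''\in \mathbb{N}_0$ such that $d= d' + d''$. Let $(X_n)_{n=1}^N$ be a Latin hypercube sample in $[0,1)^{d'}$ and let $(Y_n)_{n=1}^N$ be Monte Carlo points in $[0,1)^{d''}$, randomized independently (in particular independent of $(X_n)_{n=1}^N$). For $n=1, \ldots, N$ put $Z_n:= (X_n, Y_n)$. For $a, b \in [0,1)^d$ let $A:= [0,a)$, $B:= [0,b)$, and $D:= B \setminus A$. Then the random variables $$\mathbf{1}_D(Z_1), \ldots, \mathbf{1}_D(Z_N)$$ are $\gamma_{d'}$-negatively dependent, where $$\gamma_{d'} := \prod_{i=1}^{d'} \delta_i, \qquad \delta_i := \begin{cases} 1 & \text{if } a_i, b_i \in G^1_N \text{ or } a_i=0,\\ e & \text{else.}\end{cases}$$ In particular, the random points $(Z_n)_{n=1}^N$ are $\mathcal{C}^d_0$-negatively dependent (i.e. $\mathcal{C}^d_0$-$1$-negatively dependent) as well as $\mathcal{D}^d_0$-$e^{d'}$-negatively dependent.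
   Context: Notation: $[N]=\{1,\dots,N\}$; for $x,y\in\mathbb{R}^d$, $[x,y):=\prod_{j=1}^d[x_j,y_j)$; $\mathbf{1}_S$ is the indicator function of $S$; $G_N^1:=\{0,1/N,\dots,(N-1)/N,1\}$; $e$ is Euler's number. Latin hypercube sample: a Latin hypercube sample $(X_n)_{n=1}^N$ in $[0,1)^{d'}$ is of the form $X_{n,j}=\frac{\pi_j(n-1)+U_{n,j}}{N}$, where $X_{n,j}$ is the $j$th coordinate of $X_n$, each $\pi_j$ is a permutation of $0,1,\dots,N-1$ chosen uniformly at random, each $U_{n,j}$ is uniformly distributed in $[0,1)$, and the $d'$ permutations $\pi_j$ and the $d'N$ random variables $U_{n,j}$ are mutually independent. Monte Carlo points: independent random points uniformly distributed in $[0,1)^{d''}$. $\gamma$-negative dependence: let $\gamma\ge1$. Random variables $T_1,\dots,T_N$ with values in $\{0,1\}$ are called $\gamma$-negatively dependent if for all $u\subseteq[N]$ both $\mathbb{P}\big(\bigwedge_{j\in u}T_j=1\big)\le\gamma\prod_{j\in u}\mathbb{P}(T_j=1)$ and $\mathbb{P}\big(\bigwedge_{j\in u}T_j=0\big)\le\gamma\prod_{j\in u}\mathbb{P}(T_j=0)$. Let $\mathcal{C}^d_0:=\{[0,a)\mid a\in[0,1]^d\}$ and $\mathcal{D}^d_0:=\{B\setminus A\mid A,B\in\mathcal{C}^d_0\}$. For $\mathcal{S}\in\{\mathcal{C}^d_0,\mathcal{D}^d_0\}$, random points $X_1,\dots,X_N$ in $[0,1)^d$ are called $\mathcal{S}$-$\gamma$-negatively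 dependent if for every $S\in\mathcal{S}$ the random variables $\mathbf{1}_S(X_1),\dots,\mathbf{1}_S(X_N)$ are $\gamma$-negatively dependent; if $\gamma=1$ the reference to $\gamma$ is suppressed. *)

(* Defs.v *)
From HB Require Import structures.
From mathcomp Require Import all_boot all_order all_algebra all_fingroup.
From mathcomp Require Import all_classical all_reals all_analysis.

Set Implicit Arguments.
Unset Strict Implicit.
Unset Printing Implicit Defensive.

Import Order.TTheory GRing.Theory Num.Theory.
Import numFieldNormedType.Exports.

Local Open Scope classical_set_scope.
Local Open Scope ring_scope.

(* Points of R^n are tuples: n.-tuple R carries the product sigma-algebra,
   and the concatenation of an m-tuple and an n-tuple is an (m + n)-tuple. *)
Section Geometry.
Context {R : realType}.

Definition box n (x y : n.-tuple R) : set (n.-tuple R) :=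
  [set z | forall j, tnth x j <= tnth z j < tnth y j].

Definition anchored_box n (a : n.-tuple R) : set (n.-tuple R) :=
  box [tuple 0 | _ < n] a.

Definition cube n : set (n.-tuple R) :=
  [set z | forall j, 0 <= tnth z j < 1].

Definition closed_cube n : set (n.-tuple R) :=
  [set z | forall j, 0 <= tnth z j <= 1].

Definition C0 n : set (set (n.-tuple R)) :=
  [set anchored_box a | a in @closed_cube n].

Definition D0 n : set (set (n.-tuple R)) :=
  [set B `\` A | B in @C0 n & A in @C0 n].

Definition grid1 (N : nat) : set R :=
  [set x | exists2 k : nat, (k <= N)%N & x = k%:R / N%:R].

End Geometry.

Section Probability.
Context {dO : measure_display} {Omega : measurableType dO} {R : realType}.
Variable P : probability Omega R.

(* Mutual independence of finitely many sigma-algebras. Random elements with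
   values in different spaces are mutually independent when the sigma-algebras
   they generate are. *)
Definition mutually_independent (I : finType) (F : I -> set (set Omega)) : Prop :=
  (forall i, F i `<=` measurable) /\
  (forall (J : {set I}) (E : I -> set Omega),
     (forall i, i \in J -> F i (E i)) ->
     P (\bigcap_(i in [set` J]) E i) = (\prod_(i in J) P (E i))%E).

Definition sigma_of d (T : measurableType d) (f : Omega -> T) : set (set Omega) :=
  preimage_set_system setT f measurable.

(* Sigma-algebra of a random element of a finite type, all of whose subsets
   are measurable. *)
Definition sigma_of_fin (T : finType) (f : Omega -> T) : set (set Omega) :=
  preimage_set_system setT f [set: set T].

Definition independent_pair d1 d2 (T1 : measurableType d1)
    (T2 : measurableType d2) (f : Omega -> T1) (g : Omega -> T2) : Prop :=
  mutually_independent (fun b : bool => if b then sigma_of f else sigma_of g).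

Definition uniform_perm N (p : Omega -> {perm 'I_N}) : Prop :=
  forall s : {perm 'I_N},
    measurable (p @^-1` [set s]) /\
    P (p @^-1` [set s]) = ((N`!%:R : R)^-1)%:E.

Definition uniform01 (U : Omega -> R) : Prop :=
  [/\ measurable_fun setT U,
      forall w, 0 <= U w < 1
    & forall A : set R, measurable A ->
        P (U @^-1` A) = uniform_prob (@ltr01 R) A].

(* The law of V is Lebesgue measure on the cube, which is determined by the
   volumes of half-open boxes. *)
Definition uniform_cube n (V : Omega -> n.-tuple R) : Prop :=
  [/\ measurable_fun setT V,
      forall w, cube (V w)
    & forall x y : n.-tuple R, closed_cube x -> closed_cube y ->
        (forall j, tnth x j <= tnth y j) ->
        P (V @^-1` box x y) = (\prod_(j < n) (tnth y j - tnth x j))%:E].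

(* Sample points are indexed by 'I_N, so the index n below is n - 1 in the
   usual formula X_(n,j) = (pi_j(n - 1) + U_(n,j)) / N. *)
Definition latin_hypercube_sample N k
    (X : 'I_N -> Omega -> k.-tuple R) : Prop :=
  exists (p : 'I_k -> Omega -> {perm 'I_N}) (U : 'I_N -> 'I_k -> Omega -> R),
    [/\ forall j, uniform_perm (p j),
        forall n j, uniform01 (U n j),
        mutually_independent (fun i : 'I_k + 'I_N * 'I_k =>
          match i with
          | inl j => sigma_of_fin (p j)
          | inr nj => sigma_of (U nj.1 nj.2)
          end)
      & forall n w j,
          tnth (X n w) j = ((p j w n : nat)%:R + U n j w) / N%:R].

Definition monte_carlo N k (Y : 'I_N -> Omega -> k.-tuple R) : Prop :=
  (forall n, uniform_cube (Y n)) /\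
  mutually_independent (fun n => sigma_of (Y n)).

Definition neg_dependent N (gamma : R) (T : 'I_N -> Omega -> R) : Prop :=
  [/\ 1 <= gamma,
      forall j, measurable_fun setT (T j),
      forall j w, T j w = 0 \/ T j w = 1
    & forall u : {set 'I_N},
        (P [set w | forall j, j \in u -> T j w = 1%R] <=
           gamma%:E * \prod_(j in u) P [set w | T j w = 1%R])%E /\
        (P [set w | forall j, j \in u -> T j w = 0%R] <=
           gamma%:E * \prod_(j in u) P [set w | T j w = 0%R])%E].

Definition neg_dependent_points N n (S : set (set (n.-tuple R))) (gamma : R)
    (Z : 'I_N -> Omega -> n.-tuple R) : Prop :=
  [/\ forall i, measurable_fun setT (Z i),
      forall i w, cube (Z i w)
    & forall A, S A -> neg_dependent gamma (fun i w => \1_A (Z i w))].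

End Probability.

Section GammaFactor.
Context {R : realType}.

Definition delta (N : nat) (x y : R) : R :=
  if `[< (grid1 N x /\ grid1 N y) \/ x = 0 >] then 1 else expR 1.

Definition gamma_factor (N d' d'' : nat) (a b : (d' + d'').-tuple R) : R :=
  \prod_(i < d') delta N (tnth a (lshift d'' i)) (tnth b (lshift d'' i)).

End GammaFactor.

(* Main.v *)
Require Import Defs.
From mathcomp Require Import all_boot all_order all_algebra all_fingroup.
From mathcomp Require Import all_classical all_reals all_analysis.
From mathcomp Require Import ring lra zify.
Import Order.TTheory GRing.Theory Num.Theory.

(** The points of a Latin hypercube sample are independent once the
    permutations are fixed, and a point whose [j]-th coordinate lies in the cell
    [m] of [0, 1) falls below [c] in that coordinate with probability
    [cell_below N c m], the share of the cell that lies below [c]. Hence the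
    joint probability that every [Z_n] lies in its own anchored box is an average
    over the tuple of permutations of a product over [n]
    ([joint_anchored_boxes]). Both sides of this identity are additive under
    proper differences in each of the [N] arguments, so it extends to
    [B \ A] and to complements in the cube ([has_law_closure]). The theorem then
    becomes a statement on averages over permutations.

    The heart of the matter is one coordinate. Let [f] and [g] be nonnegative
    functions on the cells, and [s] a uniform permutation. If [f] and [g] are
    similarly ordered, the mean of a product of factors [f (s n)] and [g (s n)],
    over distinct indices [n], is at most the product of the means: adding one
    more factor [g (s m)] costs at most a factor mean of [g], because the sum
    over all [k] of [g (s k)] does not depend on [s], while placing the new factor
    on an index [k] that already carries one, instead of [m], can only increase
    the mean, by Chebyshev's inequality for similarly ordered functions
    ([perm_avg_prod_insert_le]). If the ordering fails at a single cell, at most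
    one of the indices is sent to that cell, and the cost per new factor is
    at most [N / (N - 1)] times the mean of [g]. There are at most [N - 1] new
    factors, whence the constant [e] ([labelled_perm_avg_le]).

    The dimensions are peeled off one at a time. Let [B'] and [A'] be the
    boxes in the remaining dimensions. In the first coordinate, the conditional
    probability that [Z_n] lies in [B] is [b * P(B')], and in [B \ A] it is
    [(b - a) * P(B') + a * P(B' \ A')], where [a] and [b] are now the shares of
    the cell of the point below [a_1] and [b_1]. These two functions of
    the cell are similarly ordered, except possibly at the cell that has [b_1]
    in its interior, so that cell is the only source of a factor [e]. It is absent if
    [b_1] is on the grid, and harmless if [a_1 = 0], when both functions
    coincide. The same holds for the complements ([coordinate_le]). Replacing
    [a] by the coordinatewise minimum of [a] and [b] reduces the general case to
    [a <= b] without changing [B \ A]. *)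

Set Implicit Arguments.
Unset Strict Implicit.
Unset Printing Implicit Defensive.
Local Open Scope ring_scope.

(** * Products of functions of a uniform permutation *)

Section PermAverage.
Context {R : realType} {N : nat}.
Implicit Types (F : {perm 'I_N} -> R) (f g : 'I_N -> R) (D : {set 'I_N}).

Definition perm_avg F : R := (N`!%:R)^-1 * \sum_(s : {perm 'I_N}) F s.

Definition cell_mean f : R := N%:R^-1 * \sum_m f m.

Lemma perm_avg_sum (I : finType) (F : I -> {perm 'I_N} -> R) :
  perm_avg (fun s => \sum_i F i s) = \sum_i perm_avg (F i).
Proof. by rewrite /perm_avg exchange_big mulr_sumr. Qed.

Lemma perm_avgD F1 F2 :
  perm_avg (fun s => F1 s + F2 s) = perm_avg F1 + perm_avg F2.
Proof. by rewrite /perm_avg big_split mulrDr. Qed.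

Lemma perm_avgZ c F : perm_avg (fun s => c * F s) = c * perm_avg F.
Proof. by rewrite /perm_avg -mulr_sumr mulrCA. Qed.

Lemma eq_perm_avg F1 F2 : F1 =1 F2 -> perm_avg F1 = perm_avg F2.
Proof. by move=> eqF; congr (_ * _); apply: eq_bigr => s _. Qed.

Lemma le_perm_avg F1 F2 :
  (forall s, F1 s <= F2 s) -> perm_avg F1 <= perm_avg F2.
Proof.
move=> leF; rewrite ler_wpM2l ?invr_ge0 ?ler0n//.
by apply: ler_sum => s _.
Qed.

Lemma perm_avg_cst c : perm_avg (fun=> c) = c.
Proof.
by rewrite /perm_avg sumr_const -[c *+ _]mulr_natl mulrA card_Sn mulVf ?mul1r.
Qed.

Lemma perm_avg_ge0 F : (forall s, 0 <= F s) -> 0 <= perm_avg F.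
Proof. by move=> F0; rewrite -(perm_avg_cst 0) le_perm_avg. Qed.

Lemma perm_avg_swap k m F :
  perm_avg F = perm_avg (fun s => F (tperm k m * s)%g).
Proof.
congr (_ * _); rewrite (reindex_inj (mulgI (tperm k m))).
by apply: eq_bigr => s _.
Qed.

Lemma sum_over_perm (s : {perm 'I_N}) f : \sum_k f (s k) = \sum_m f m.
Proof. by rewrite [RHS](reindex_inj (@perm_inj _ s)). Qed.

(** The values [s n], for the different [n], are equidistributed, and
    together they exhaust the cells. *)
Lemma perm_avg_at n f : perm_avg (fun s => f (s n)) = cell_mean f.
Proof.
have N0 : N%:R != 0 :> R by rewrite pnatr_eq0 -lt0n (leq_ltn_trans _ (ltn_ord n)).
have same k : perm_avg (fun s => f (s k)) = perm_avg (fun s => f (s n)).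
  by rewrite (perm_avg_swap k n); apply: eq_perm_avg => s; rewrite permM tpermL.
have : \sum_k perm_avg (fun s => f (s k)) = \sum_m f m.
  rewrite -perm_avg_sum -[RHS]perm_avg_cst.
  by apply: eq_perm_avg => s; exact: sum_over_perm.
rewrite (eq_bigr _ (fun k _ => same k)) sumr_const card_ord -mulr_natl.
by move=> eqS; rewrite /cell_mean -eqS mulrA mulVf// mul1r.
Qed.

(** Off [D] this is the hypothesis of Chebyshev's sum inequality. A pair that
    meets [D] may violate it, but by no more than the product in which [f] takes
    its value on [D]. Summed over the indices that carry [f], such losses count
    the indices sent into [D], of which an injective map has at most [#|D|]. *)
Definition similarly_ordered_off D f g : Prop := forall x y,
  - ((x \in D)%:R * (f x * g y)) - (y \in D)%:R * (f y * g x)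
    <= (f x - f y) * (g x - g y).

(** The index [m] carries no factor yet. Averaging with the permutation
    precomposed with the transposition of [k] and [m] turns the difference of the
    two sides into an average of [(h k x - h k y) * (g x - g y)], with
    [x = s k] and [y = s m], plus the admissible loss. *)
Lemma perm_avg_prod_swap_le (h : 'I_N -> 'I_N -> R) D k m g :
  k != m -> (forall i x, 0 <= h i x) -> (forall x, h m x = 1) ->
  similarly_ordered_off D (h k) g ->
  perm_avg (fun s => \prod_i h i (s i) * g (s m)) <=
  perm_avg (fun s => \prod_i h i (s i) * g (s k)) +
  perm_avg (fun s => \prod_i h i (s i) * g (s m) * (s k \in D)%:R).
Proof.
move=> km h0 hm1 sim.
pose Q (s : {perm 'I_N}) := \prod_(i | (i != k) && (i != m)) h i (s i).
have hQ (s : {perm _}) : \prod_i h i (s i) = h k (s k) * Q s.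
  rewrite (bigD1 k)//= (bigD1 m)//=; last by rewrite eq_sym.
  by rewrite hm1 mul1r.
have Qsw (s : {perm _}) : Q (tperm k m * s)%g = Q s.
  by apply: eq_bigr => i /andP[ik im]; rewrite permM tpermD// eq_sym.
have Q0 s : 0 <= Q s by apply: prodr_ge0.
pose L (s : {perm 'I_N}) := Q s * (h k (s k) * g (s k)
  + h k (s k) * g (s m) * (s k \in D)%:R - h k (s k) * g (s m)).
suff : 0 <= perm_avg L.
  rewrite (_ : perm_avg L = perm_avg (fun s => \prod_i h i (s i) * g (s k)) +
    perm_avg (fun s => \prod_i h i (s i) * g (s m) * (s k \in D)%:R) +
    perm_avg (fun s => - 1 * (\prod_i h i (s i) * g (s m)))).
    by rewrite perm_avgZ mulN1r subr_ge0.
  rewrite -!perm_avgD; apply: eq_perm_avg => s; rewrite /L hQ; ring.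
(* The two copies of the average are symmetrized against each other. *)
suff : 0 <= perm_avg L + perm_avg L by lra.
rewrite {2}(perm_avg_swap k m) -perm_avgD; apply: perm_avg_ge0 => s.
rewrite /L Qsw !permM tpermL tpermR -mulrDr; apply: mulr_ge0 => //.
have := sim (s k) (s m); lra.
Qed.

(** The sum of [g (s k)] over all [k] is [N * cell_mean g] for every [s]. Each
    of its terms is compared with the one at the free index [m] by
    [perm_avg_prod_swap_le]; the losses are weighted by the number of
    indices in [S] sent into [D], hence bounded by [#|D|] in total. *)
Lemma perm_avg_prod_insert_le (h : 'I_N -> 'I_N -> R) (S D : {set 'I_N}) m g :
  (forall i x, 0 <= h i x) -> (forall x, 0 <= g x) -> (forall x, h m x = 1) ->
  (forall k, similarly_ordered_off (if k \in S then D else finset.set0) (h k) g) ->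
  (N%:R - #|D|%:R) * perm_avg (fun s => \prod_i h i (s i) * g (s m)) <=
  N%:R * cell_mean g * perm_avg (fun s => \prod_i h i (s i)).
Proof.
move=> h0 g0 hm1 sim.
have N0 : N%:R != 0 :> R by rewrite pnatr_eq0 -lt0n (leq_ltn_trans _ (ltn_ord m)).
set A := perm_avg (fun s => _ * g (s m)).
have -> : N%:R * cell_mean g * perm_avg (fun s => \prod_i h i (s i)) =
    \sum_k perm_avg (fun s => \prod_i h i (s i) * g (s k)).
  rewrite /cell_mean mulVKf// -perm_avgZ -perm_avg_sum; apply: eq_perm_avg => s.
  by rewrite -mulr_sumr sum_over_perm mulrC.
pose c (s : {perm 'I_N}) := \sum_(k in S) (s k \in D)%:R : R.
have cD (s : {perm _}) : c s <= #|D|%:R.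
  rewrite /c (le_trans (y := \sum_k (s k \in D)%:R))//.
    by rewrite [leRHS](bigID (mem S))/= lerDl sumr_ge0// => i _; rewrite ler0n.
  rewrite (sum_over_perm s (fun x => (x \in D)%:R)) -sum1_card natr_sum.
  by rewrite [in leRHS]big_mkcond/= ler_sum// => i _; case: (i \in D).
have loss : perm_avg (fun s => \prod_i h i (s i) * g (s m) * c s) <= #|D|%:R * A.
  rewrite /A -perm_avgZ; apply: le_perm_avg => s.
  by rewrite mulrC ler_wpM2r// mulr_ge0// prodr_ge0.
have termwise : \sum_(k : 'I_N) A <=
    \sum_k (perm_avg (fun s => \prod_i h i (s i) * g (s k)) +
      (k \in S)%:R * perm_avg (fun s => \prod_i h i (s i) * g (s m) * (s k \in D)%:R)).
  apply: ler_sum => k _.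
  have rest0 : 0 <= perm_avg (fun s => \prod_i h i (s i) * g (s m) * (s k \in D)%:R).
    apply: perm_avg_ge0 => s; apply: mulr_ge0; last exact: ler0n.
    by apply: mulr_ge0 => //; exact: prodr_ge0.
  rewrite /A; case: (eqVneq k m) rest0 => [<-|km] rest0.
    by rewrite lerDl mulr_ge0 ?ler0n.
  apply: (le_trans (perm_avg_prod_swap_le km h0 hm1 (sim k))); rewrite lerD2l.
  case: (k \in S); first by rewrite mul1r.
  rewrite mul0r (eq_perm_avg (F2 := fun=> 0)) ?perm_avg_cst// => s.
  by rewrite finset.in_set0 mulr0.
rewrite sumr_const card_ord -mulr_natl big_split/= in termwise.
rewrite mulrBl lerBlDr (le_trans termwise)// lerD2l (le_trans _ loss)//.
under eq_bigr => k _ do rewrite -perm_avgZ.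
rewrite -perm_avg_sum; apply: le_perm_avg => s.
rewrite /c mulr_sumr [leRHS]big_mkcond/= ler_sum// => k _.
by case: (k \in S); rewrite ?mul1r ?mul0r.
Qed.

End PermAverage.

(** The choice of a factor for each index: none, the first, or the second. *)
Definition labelled {T : Type} (t0 t1 t2 : T) (l : option bool) : T :=
  if l is Some b then (if b then t2 else t1) else t0.

Section PermProducts.
Context {R : realType} {N : nat}.
Implicit Types (f g : 'I_N -> R) (D S T : {set 'I_N}).

Lemma similarly_ordered_self f : similarly_ordered_off finset.set0 f f.
Proof. by move=> x y; rewrite !finset.in_set0 !mul0r subr0 oppr0 -expr2 sqr_ge0. Qed.

Lemma similarly_ordered_cst1 D f g :
  (forall x, f x = 1) -> (forall x, 0 <= g x) -> similarly_ordered_off D f g.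
Proof.
move=> f1 g0 x y; rewrite !f1 subrr mul0r subr_le0 (@le_trans _ _ 0)//.
  by rewrite oppr_le0 !mulr_ge0.
by rewrite !mulr_ge0.
Qed.

(** For a pair with exactly one point [x] in [D], the asymmetric condition
    suffices because the product [f x * g y] is covered by the loss. *)
Lemma similarly_ordered_criterion D f g :
  (forall x, 0 <= f x) -> (forall x, 0 <= g x) ->
  (forall x y, x \notin D -> y \notin D -> 0 <= (f x - f y) * (g x - g y)) ->
  (forall x y, x \in D -> y \notin D -> f y * g x <= f x * g x + f y * g y) ->
  similarly_ordered_off D f g.
Proof.
move=> f0 g0 outside inside x y.
have [fgx fgy] : 0 <= f x * g x /\ 0 <= f y * g y by rewrite !mulr_ge0.
have [xD|xD] := boolP (x \in D); have [yD|yD] := boolP (y \in D);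
  rewrite /= ?mulr1n ?mulr0n ?mul1r ?mul0r.
- by nra.
- by have := inside x y xD yD; nra.
- by have := inside y x yD xD; nra.
- by have := outside x y xD yD; nra.
Qed.

(** Iteration of [perm_avg_prod_insert_le] over the indices of [T]. Only the
    indices of [S] may meet the defect [D]: among the factors [g] already
    inserted, similar ordering is automatic. *)
Lemma perm_avg_prod_insert_many_le (h : 'I_N -> 'I_N -> R) S D T g :
  (forall i x, 0 <= h i x) -> (forall x, 0 <= g x) ->
  (forall i x, i \in T -> h i x = 1) -> [disjoint S & T] ->
  (forall k, k \notin T ->
    similarly_ordered_off (if k \in S then D else finset.set0) (h k) g) ->
  (N%:R - #|D|%:R) ^+ #|T| *
    perm_avg (fun s => \prod_i (if i \in T then g else h i) (s i)) <=
  (N%:R * cell_mean g) ^+ #|T| * perm_avg (fun s => \prod_i h i (s i)).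
Proof.
move=> h0 g0; move eqt : #|T| => t; elim: t T eqt => [|t IH] T eqt h1 dis sim.
  rewrite !expr0 !mul1r (eq_perm_avg (F2 := fun s => \prod_i h i (s i)))// => s.
  by apply: eq_bigr => i _; rewrite (cards0_eq eqt) finset.in_set0.
have [m mT] : {m | m \in T} by apply/sigW/card_gt0P; rewrite eqt.
pose T' := (T :\ m)%SET.
have T'T i : i \in T' -> i \in T by rewrite !inE => /andP[].
pose h' i := if i \in T' then g else h i.
have ND : 0 <= N%:R - #|D|%:R :> R.
  by rewrite subr_ge0 ler_nat (leq_trans (max_card _))// card_ord.
have mu0 : 0 <= N%:R * cell_mean g.
  by rewrite !mulr_ge0 ?invr_ge0// sumr_ge0.
have {}IH : (N%:R - #|D|%:R) ^+ t * perm_avg (fun s => \prod_i h' i (s i)) <=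
    (N%:R * cell_mean g) ^+ t * perm_avg (fun s => \prod_i h i (s i)).
  apply: IH => [|i x /T'T||k].
  - by move: eqt; rewrite (cardsD1 m) mT => -[].
  - exact: h1.
  - by apply: disjointWr dis; apply/fintype.subsetP => i /T'T.
  - rewrite !inE negb_and negbK => /orP[/eqP ->|]; last exact: sim.
    by apply: similarly_ordered_cst1 => // x; exact: h1.
rewrite exprSr exprS -[leLHS]mulrA -[leRHS]mulrA (le_trans (y := (N%:R - #|D|%:R) ^+ t *
  (N%:R * cell_mean g * perm_avg (fun s => \prod_i h' i (s i)))))//; last first.
  by rewrite mulrCA ler_wpM2l.
rewrite ler_wpM2l ?exprn_ge0//.
rewrite (eq_perm_avg (F2 := fun s => \prod_i h' i (s i) * g (s m))).
  apply: (@perm_avg_prod_insert_le _ _ _ S) => //.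
  - by move=> i x; rewrite /h'; case: ifP.
  - by move=> x; rewrite /h' !inE eqxx/= h1.
  - move=> k; rewrite /h'; have [kT'|_] := boolP (k \in T').
      by rewrite (disjointFl dis (T'T _ kT')); exact: similarly_ordered_self.
    have [kT|kT] := boolP (k \in T); last exact: sim.
    by apply: similarly_ordered_cst1 => // x; exact: h1.
move=> s; rewrite (bigD1 m)//= mT [in RHS](bigD1 m)//= /h' !inE eqxx/= h1// mul1r.
rewrite mulrC; congr (_ * _); apply: eq_bigr => i im.
by rewrite !inE im.
Qed.

(** The factors [f] are inserted first, at no loss, then the factors [g]. For
    one defective cell the loss is [(N / (N - 1)) ^ t], where [t] counts the
    factors [g]; as soon as there is a factor [f], [t <= N - 1]. *)
Lemma labelled_perm_avg_le (lab : 'I_N -> option bool) D f g (C : R) :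
  (forall x, 0 <= f x) -> (forall x, 0 <= g x) -> (#|D| <= 1)%N ->
  similarly_ordered_off D f g -> 1 <= C -> (D != finset.set0 -> expR 1 <= C) ->
  perm_avg (fun s => \prod_n labelled (fun=> 1) f g (lab n) (s n)) <=
  C * \prod_n labelled 1 (cell_mean f) (cell_mean g) (lab n).
Proof.
move=> f0 g0 D1 sim C1 Ce.
pose S := [set n | lab n == Some false]%SET; pose T := [set n | lab n == Some true]%SET.
have dis : [disjoint S & T].
  apply/pred0P => n /=; rewrite !inE; by case: (lab n) => [[]|].
have -> : \prod_n labelled 1 (cell_mean f) (cell_mean g) (lab n) =
    cell_mean f ^+ #|S| * cell_mean g ^+ #|T|.
  rewrite -!prodr_const [X in X * _]big_mkcond [X in _ * X]big_mkcond -big_split/=.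
  apply: eq_bigr => n _; rewrite !inE.
  by case: (lab n) => [[]|]; rewrite ?mul1r ?mulr1.
pose h i := if i \in S then f else fun=> 1 : R.
have -> : perm_avg (fun s => \prod_n labelled (fun=> 1) f g (lab n) (s n)) =
    perm_avg (fun s => \prod_i (if i \in T then g else h i) (s i)).
  apply: eq_perm_avg => s; apply: eq_bigr => n _; rewrite /h !inE.
  by case: (lab n) => [[]|].
have [N0|N0] := posnP N.
  have noi (i : 'I_N) : False by move: (ltn_ord i); rewrite {2}N0.
  have empty (A : {set 'I_N}) : #|A| = 0%N.
    by apply: eq_card0 => i; case: (noi i).
  rewrite !empty !expr0 !mulr1 (eq_perm_avg (F2 := fun=> 1)) ?perm_avg_cst//.
  by move=> s; rewrite big1// => i; case: (noi i).
have NR : 0 < N%:R :> R by rewrite ltr0n.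
have h0 i x : 0 <= h i x by rewrite /h; case: ifP.
have muf : 0 <= cell_mean f by rewrite mulr_ge0 ?invr_ge0// sumr_ge0.
have mug : 0 <= cell_mean g by rewrite mulr_ge0 ?invr_ge0// sumr_ge0.
have avgS : perm_avg (fun s => \prod_i h i (s i)) <= cell_mean f ^+ #|S|.
  have := @perm_avg_prod_insert_many_le (fun _ _ => 1) finset.set0 finset.set0 S f.
  rewrite cards0 subr0 exprMn -mulrA ler_pM2l ?exprn_gt0//.
  rewrite [X in _ <= _ ^+ _ * X](eq_perm_avg (F2 := fun=> 1)); last first.
    by move=> s; rewrite big1.
  rewrite perm_avg_cst mulr1; apply => //.
    by apply/pred0P => i /=; rewrite finset.in_set0.
  by move=> k _; exact: similarly_ordered_cst1.
have h1 i x : i \in T -> h i x = 1.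
  by move=> iT; rewrite /h (disjointFl dis iT).
set A := perm_avg _ in avgS *; set B := perm_avg _.
have B0 : 0 <= B.
  by apply: perm_avg_ge0 => s; apply: prodr_ge0 => i _; case: ifP.
(* Without defect, or without a factor f that could meet it, nothing is lost. *)
have exact_case E : E = finset.set0 \/ S = finset.set0 -> similarly_ordered_off E f g ->
    B <= C * (cell_mean f ^+ #|S| * cell_mean g ^+ #|T|).
  move=> ES simE; rewrite (le_trans (y := cell_mean f ^+ #|S| * cell_mean g ^+ #|T|))//.
    have := @perm_avg_prod_insert_many_le h S finset.set0 T g h0 g0 h1 dis.
    rewrite cards0 subr0 exprMn -mulrA ler_pM2l ?exprn_gt0// => le.
    rewrite mulrC (le_trans (le _))//; last by rewrite ler_wpM2l ?exprn_ge0.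
    move=> k kT; rewrite if_same /h; case: ES => [E0|S0].
      by case: ifP => _; [rewrite -E0|exact: similarly_ordered_cst1].
    by rewrite S0 finset.in_set0; exact: similarly_ordered_cst1.
  by rewrite ler_peMl// mulr_ge0 ?exprn_ge0.
have [D0|D0] := eqVneq D finset.set0; first by apply: (exact_case D) => //; left.
have [S0|S0] := eqVneq S finset.set0; first by apply: (exact_case D) => //; right.
have cD : #|D| = 1%N by apply/eqP; rewrite eqn_leq D1 card_gt0.
have sT : (#|T| <= N.-1)%N.
  have : (#|S| + #|T| <= N)%N.
    rewrite -cardsUI (_ : (S :&: T)%SET = finset.set0) ?cards0 ?addn0.
      by rewrite (leq_trans (max_card _))// card_ord.
    by apply/disjoint_setI0.
  rewrite -card_gt0 in S0; lia.
have := @perm_avg_prod_insert_many_le h S D T g h0 g0 h1 dis.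
rewrite cD -/A -/B; set t := #|T| in sT *.
move=> le; have {}le := le _.
have {le} : (N%:R - 1) ^+ t * B <= (N%:R * cell_mean g) ^+ t * A.
  by apply: le => k _; rewrite /h; case: ifP => // _; exact: similarly_ordered_cst1.
set n := N.-1 in sT; have -> : N%:R = n%:R + 1 :> R by rewrite natr1 prednK.
rewrite addrK exprMn => le.
(* (1 + 1/n)^t <= exp(t/n) <= e for t <= n; if n = 0 then t = 0. *)
have [pos ratio] : 0 < n%:R ^+ t :> R /\ (n%:R + 1) ^+ t <= expR 1 * n%:R ^+ t :> R.
  have [n0|n0] := posnP n.
    have -> : t = 0%N by apply/eqP; rewrite -leqn0 -n0.
    by rewrite !expr0 mulr1; split=> //; rewrite (le_trans _ (expR_ge1Dx _))// lerDl.
  have nR : 0 < n%:R :> R by rewrite ltr0n.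
  split; first by rewrite exprn_gt0.
  rewrite (_ : n%:R + 1 = (1 + n%:R^-1) * n%:R); last by field; rewrite gt_eqF.
  rewrite exprMn ler_wpM2r ?exprn_ge0//.
  rewrite (le_trans (y := expR (n%:R^-1) ^+ t))//.
    by rewrite lerXn2r ?nnegrE ?expR_ge0 ?expR_ge1Dx// addr_ge0 ?invr_ge0// ltW.
  by rewrite -expRM_natl ler_expR ler_pdivrMr// mul1r ler_nat.
rewrite -(ler_pM2l pos) (le_trans le)//.
rewrite (le_trans (y := expR 1 * n%:R ^+ t * cell_mean g ^+ t * cell_mean f ^+ #|S|))//.
  apply: ler_pM => //.
  - by rewrite mulr_ge0 ?exprn_ge0 ?addr_ge0.
  - by apply: perm_avg_ge0 => s; apply: prodr_ge0.
  - by rewrite ler_wpM2r ?exprn_ge0.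
rewrite (_ : _ * _ * _ * _ = expR 1 * (n%:R ^+ t * (cell_mean f ^+ #|S| * cell_mean g ^+ t))).
  rewrite [leRHS]mulrCA ler_wpM2r ?Ce// !mulr_ge0 ?exprn_ge0//.
ring.
Qed.

End PermProducts.

(** * The cells of a Latin hypercube sample in one coordinate *)

Section Cells.
Context {R : realType}.
Implicit Types (a b c x y A B : R) (N : nat).

(** [N] times the length of the intersection of [0, c) with the cell
    [m / N, (m + 1) / N), for [c >= 0]. As a difference of minima it telescopes
    in [m]. *)
Definition cell_below N c (m : nat) : R :=
  Num.min (N%:R * c) m.+1%:R - Num.min (N%:R * c) m%:R.

Lemma cell_below_full N c m : m.+1%:R <= N%:R * c -> cell_below N c m = 1.
Proof.
move=> le; rewrite /cell_below !min_r//; first by rewrite -natr1; ring.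
by rewrite (le_trans _ le)// ler_nat.
Qed.

Lemma cell_below_empty N c m : N%:R * c <= m%:R -> cell_below N c m = 0.
Proof.
move=> le; rewrite /cell_below !min_l ?subrr//.
by rewrite (le_trans le)// ler_nat.
Qed.

Lemma cell_below_partial N c m : m%:R < N%:R * c < m.+1%:R ->
  cell_below N c m = N%:R * c - m%:R.
Proof.
by move=> /andP[lo hi]; rewrite /cell_below min_l ?min_r// ltW.
Qed.

Variant cell_below_spec N c (m : nat) : R -> bool -> Type :=
  | CellFull of m.+1%:R <= N%:R * c : cell_below_spec N c m 1 false
  | CellEmpty of N%:R * c <= m%:R : cell_below_spec N c m 0 false
  | CellPartial of m%:R < N%:R * c < m.+1%:R :
      cell_below_spec N c m (N%:R * c - m%:R) true.

Lemma cell_belowP N c m :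
  cell_below_spec N c m (cell_below N c m) (m%:R < N%:R * c < m.+1%:R).
Proof.
have [le|lt] := leP m.+1%:R (N%:R * c).
  by rewrite andbF cell_below_full//; constructor.
have [le|lt'] := leP (N%:R * c) m%:R.
  by rewrite /= cell_below_empty//; constructor.
by rewrite /= cell_below_partial ?lt' ?lt//; constructor; rewrite lt' lt.
Qed.

Lemma cell_below_ge0 N c m : 0 <= cell_below N c m.
Proof. by case: cell_belowP => // /andP[/ltW lo _]; rewrite subr_ge0. Qed.

Lemma cell_below_le1 N c m : cell_below N c m <= 1.
Proof. by case: cell_belowP => // /andP[_ /ltW]; rewrite -natr1 lerBlDl. Qed.

Lemma cell_below_le N a b m : a <= b -> cell_below N a m <= cell_below N b m.
Proof.
move=> ab; have le : N%:R * a <= N%:R * b by rewrite ler_wpM2l.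
case: (cell_belowP N b m) => [_|hi|/andP[lo hi]].
- exact: cell_below_le1.
- by rewrite cell_below_empty ?(le_trans le).
- case: cell_belowP => [full|_|_]; last by rewrite lerB.
    by have := le_trans full le; rewrite leNgt hi.
  by rewrite subr_ge0 ltW.
Qed.

Lemma cell_below0 N m : cell_below N 0 m = 0.
Proof. by rewrite cell_below_empty ?mulr0. Qed.

Lemma cell_mean_below N c : (0 < N)%N -> 0 <= c <= 1 ->
  cell_mean (fun m : 'I_N => cell_below N c m) = c.
Proof.
move=> N0 /andP[c0 c1]; rewrite /cell_mean.
rewrite -(big_mkord xpredT (cell_below N c)) telescope_sumr//.
rewrite min_l ?min_r ?subr0 ?mulr_ge0//; last by rewrite ler_piMr.
by rewrite mulrA mulVf ?mul1r// pnatr_eq0 -lt0n.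
Qed.

(** The cells that have [c] in their interior. *)
Definition partial_cells N c : {set 'I_N} :=
  [set m : 'I_N | (m%:R < N%:R * c < m.+1%:R)]%SET.

Lemma card_partial_cells N c : (#|partial_cells N c| <= 1)%N.
Proof.
apply/card_le1P => m; rewrite inE => /andP[m1 m2] k.
rewrite !inE -val_eqE/= eqn_leq; apply/idP/idP; last first.
  by rewrite -eqn_leq => /eqP ->; rewrite m1 m2.
move=> /andP[k1 k2].
apply/andP; split; rewrite -ltnS -(ltr_nat R).
  exact: lt_trans k1 m2.
exact: lt_trans m1 k2.
Qed.

Lemma partial_cells_grid N c : grid1 N c -> partial_cells N c = finset.set0.
Proof.
case=> k kN ->; apply/setP => m; rewrite !inE.
have N0 : (0 < N)%N by apply: leq_ltn_trans (ltn_ord m).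
rewrite mulrCA divff ?mulr1 ?pnatr_eq0 -?lt0n//.
by rewrite !ltr_nat ltnS ltnNge andNb.
Qed.

(** Both halves of negative dependence are handled at once, through the probability
    of the event ([k = false]) or of its complement ([k = true]). *)
Definition complement_if (k : bool) x : R := if k then 1 - x else x.

Lemma complement_if_ge0 k x : 0 <= x <= 1 -> 0 <= complement_if k x.
Proof. by case: k => /andP[]//= _; rewrite subr_ge0. Qed.

Lemma cell_mean_complement_if N k (h : 'I_N -> R) : (0 < N)%N ->
  cell_mean (fun m => complement_if k (h m)) = complement_if k (cell_mean h).
Proof.
move=> N0; case: k => //=; rewrite /cell_mean sumrB mulrBr sumr_const card_ord.
by rewrite mulVf// pnatr_eq0 -lt0n.
Qed.

(** A point is in the large box iff its first coordinate is below [b] and the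
    others are in a set of probability [B], and in the small box iff the first
    is below [a] and the others are in a subset, of probability [A]. On a cell
    beyond [b] both functions of the cell equal [k], which is their common minimum
    or maximum; on a cell below [b] the first one is constant. So they are
    similarly ordered off the cell cut by [b]. *)
Lemma coordinate_le N k a b A B (C : R) (lab : 'I_N -> option bool) :
  (0 < N)%N -> 0 <= a -> a <= b -> b <= 1 -> 0 <= A -> A <= B -> B <= 1 ->
  1 <= C -> (grid1 N b \/ a = 0) \/ expR 1 <= C ->
  perm_avg (fun s => \prod_n labelled 1
    (complement_if k (cell_below N b (s n) * B))
    (complement_if k (cell_below N b (s n) * B - cell_below N a (s n) * A)) (lab n))
  <= C * \prod_n labelled 1 (complement_if k (b * B))
                            (complement_if k (b * B - a * A)) (lab n).
Proof.
move=> N0 a0 ab b1 A0 AB B1 C1 hC.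
pose f (m : 'I_N) := complement_if k (cell_below N b m * B).
pose g (m : 'I_N) := complement_if k (cell_below N b m * B - cell_below N a m * A).
have B0 := le_trans A0 AB; have A1 := le_trans AB B1.
have prod_bounds (m : 'I_N) : 0 <= cell_below N a m * A <= cell_below N b m * B /\
    cell_below N b m * B <= 1.
  rewrite mulr_ge0 ?cell_below_ge0//=; split.
    by rewrite ler_pM ?cell_below_ge0 ?cell_below_le.
  by rewrite mulr_ile1 ?cell_below_ge0 ?cell_below_le1.
have f0 m : 0 <= f m.
  have [/andP[u v] w] := prod_bounds m.
  by apply: complement_if_ge0; rewrite w (le_trans u v).
have g0 m : 0 <= g m.
  have [/andP[u v] w] := prod_bounds m.
  by apply: complement_if_ge0; lra.
have mean_b : cell_mean (fun m : 'I_N => cell_below N b m) = b.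
  by rewrite cell_mean_below// b1 (le_trans a0).
have mean_a : cell_mean (fun m : 'I_N => cell_below N a m) = a.
  by rewrite cell_mean_below// a0 (le_trans ab).
have mean_f : cell_mean f = complement_if k (b * B).
  rewrite cell_mean_complement_if//; congr complement_if.
  by rewrite /cell_mean -mulr_suml mulrA; congr (_ * _).
have mean_g : cell_mean g = complement_if k (b * B - a * A).
  rewrite cell_mean_complement_if//; congr complement_if.
  by rewrite /cell_mean sumrB -!mulr_suml mulrBr !mulrA; congr (_ * _ - _ * _).
have labelledE (lab' : 'I_N -> option bool) (f1 f2 : 'I_N -> R) n m :
    labelled (fun=> 1) f1 f2 (lab' n) m = labelled 1 (f1 m) (f2 m) (lab' n).
  by case: (lab' n) => [[]|].
rewrite -mean_f -mean_g.
rewrite (eq_perm_avg (F2 := fun s => \prod_n labelled (fun=> 1) f g (lab n) (s n))); last first.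
  by move=> s; apply: eq_bigr => n _; rewrite labelledE.
have [a_eq0|a_neq0] := eqVneq a 0.
  apply: (@labelled_perm_avg_le _ _ lab finset.set0) => //.
  - by rewrite cards0.
  - rewrite (_ : g = f); first exact: similarly_ordered_self.
    by apply/funext => m; rewrite /g a_eq0 cell_below0 mul0r subr0.
  - by rewrite eqxx.
have hD : partial_cells N b != finset.set0 -> expR 1 <= C.
  move=> D0; case: hC => // -[/partial_cells_grid D0'|a_eq0].
    by rewrite D0' eqxx in D0.
  by rewrite a_eq0 eqxx in a_neq0.
have gE (m : 'I_N) : N%:R * b <= m%:R -> cell_below N a m = 0.
  by move=> /cell_below_empty b_empty; apply/eqP; rewrite eq_le cell_below_ge0 andbT
    -b_empty cell_below_le.
(* The condition on the cut cell is not symmetric in the two functions: it holds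
   with f first for the complements, and with g first for the events. *)
case: k @f @g f0 g0 {mean_f mean_g labelledE} => f g f0 g0.
  apply: (@labelled_perm_avg_le _ _ lab (partial_cells N b)) => //.
    exact: card_partial_cells.
  apply: similarly_ordered_criterion => // x y; rewrite !inE.
    rewrite /f /g /=; case: cell_belowP => // hx _; case: cell_belowP => // hy _.
    - by rewrite subrr mul0r.
    - rewrite (gE y)//; have := prod_bounds x; rewrite (cell_below_full hx) => -[/andP[]]; nra.
    - rewrite (gE x)//; have := prod_bounds y; rewrite (cell_below_full hy) => -[/andP[]]; nra.
    - by rewrite subrr mul0r.
  move=> _ ny; have [/andP[_ pos] le1] := prod_bounds x.
  have [full|empty] : cell_below N b y = 1 \/ cell_below N b y = 0 /\ cell_below N a y = 0.
  - by move: ny; case: cell_belowP => // [_|/gE ay] _; [left|right].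
  - rewrite -[leLHS]addr0 lerD ?mulr_ge0// ler_wpM2r//.
    by rewrite /f /= full lerB// ler_wpM2r// cell_below_le1.
  - rewrite /f /g /= in f0 g0 *; rewrite {}empty.1 {}empty.2; move: (f0 x) (g0 x); nra.
have relabel (T : Type) (t0 t1 t2 : T) l :
    labelled t0 t1 t2 l = labelled t0 t2 t1 (omap negb l).
  by case: l => [[]|].
under eq_bigr => n _ do rewrite relabel.
rewrite (eq_perm_avg (F2 := fun s =>
    \prod_n labelled (fun=> 1) g f (omap negb (lab n)) (s n))); last first.
  by move=> s; apply: eq_bigr => n _; rewrite relabel.
apply: (@labelled_perm_avg_le _ _ _ (partial_cells N b)) => //.
  exact: card_partial_cells.
apply: similarly_ordered_criterion => // x y; rewrite !inE.
  rewrite /f /g /=; case: cell_belowP => // hx _; case: cell_belowP => // hy _.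
  - by rewrite subrr mulr0.
  - rewrite (gE y)//; have := prod_bounds x; rewrite (cell_below_full hx) => -[/andP[]]; nra.
  - rewrite (gE x)//; have := prod_bounds y; rewrite (cell_below_full hy) => -[/andP[]]; nra.
  - by rewrite subrr mulr0.
move=> _ ny.
have [full|empty] : cell_below N b y = 1 \/ cell_below N b y = 0 /\ cell_below N a y = 0.
- by move: ny; case: cell_belowP => // [_|/gE ay] _; [left|right].
- rewrite -[leLHS]add0r; apply: lerD; first exact: mulr_ge0.
  rewrite ler_wpM2l//.
  by rewrite /f /= full ler_wpM2r// cell_below_le1.
- have -> : g y = 0 by rewrite /g /= empty.1 empty.2 !mul0r subr0.
  by rewrite !mul0r addr0 mulr_ge0.
Qed.

End Cells.

(** * Independent permutations in several coordinates *)

Section Dimensions.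
Context {R : realType} {N : nat}.

(** The average over [d] independent uniform permutations. *)
Definition perms_avg d (F : ('I_d -> {perm 'I_N}) -> R) : R :=
  (N`!%:R)^-1 ^+ d * \sum_(s : {ffun 'I_d -> {perm 'I_N}}) F s.

Definition fun_cons d (T : Type) (t : T) (s : 'I_d -> T) (i : 'I_d.+1) : T :=
  if unlift ord0 i is Some j then s j else t.

Lemma fun_cons0 d (T : Type) (t : T) (s : 'I_d -> T) : fun_cons t s ord0 = t.
Proof. by rewrite /fun_cons unlift_none. Qed.

Lemma fun_consS d (T : Type) (t : T) (s : 'I_d -> T) j :
  fun_cons t s (lift ord0 j) = s j.
Proof. by rewrite /fun_cons liftK. Qed.

Lemma perms_avg0 (F : ('I_0 -> {perm 'I_N}) -> R) (s : 'I_0 -> {perm 'I_N}) :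
  perms_avg F = F s.
Proof.
rewrite /perms_avg expr0 mul1r (big_pred1 (finfun s)) => [|t].
  by congr F; apply/funext => -[].
by apply/esym/eqP/ffunP => -[].
Qed.

Lemma perms_avgS d (F : ('I_d.+1 -> {perm 'I_N}) -> R) :
  perms_avg F = perm_avg (fun p => perms_avg (fun s => F (fun_cons p s))).
Proof.
rewrite /perms_avg /perm_avg -mulr_sumr mulrA -exprS; congr (_ * _).
pose cons (ps : {perm 'I_N} * {ffun 'I_d -> {perm 'I_N}}) : {ffun 'I_d.+1 -> _} :=
  [ffun i => fun_cons ps.1 ps.2 i].
rewrite pair_big/= (reindex cons)/=; last first.
  exists (fun s => (s ord0, [ffun j => s (lift ord0 j)])) => [[p s] _|s _].
    rewrite /cons ffunE fun_cons0; congr pair; apply/ffunP => j.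
    by rewrite !ffunE fun_consS.
  apply/ffunP => i; rewrite ffunE /= /fun_cons.
  by case: unliftP => [j ->|->]; rewrite ?ffunE.
by apply: eq_bigr => ps _; congr F; apply/funext => i; rewrite ffunE.
Qed.

Lemma perms_avg_sum d (I : finType) (F : I -> ('I_d -> {perm 'I_N}) -> R) :
  perms_avg (fun s => \sum_i F i s) = \sum_i perms_avg (F i).
Proof. by rewrite /perms_avg exchange_big mulr_sumr. Qed.

Lemma perms_avgZ d c (F : ('I_d -> {perm 'I_N}) -> R) :
  perms_avg (fun s => c * F s) = c * perms_avg F.
Proof. by rewrite /perms_avg -mulr_sumr mulrCA. Qed.

Lemma perms_avgB d (F1 F2 : ('I_d -> {perm 'I_N}) -> R) :
  perms_avg (fun s => F1 s - F2 s) = perms_avg F1 - perms_avg F2.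
Proof. by rewrite /perms_avg sumrB mulrBr. Qed.

Lemma eq_perms_avg d (F1 F2 : ('I_d -> {perm 'I_N}) -> R) :
  F1 =1 F2 -> perms_avg F1 = perms_avg F2.
Proof. by move=> eqF; congr (_ * _); apply: eq_bigr => s _. Qed.

(** A product inequality that holds for all choices among finitely many factors
    passes to nonnegative combinations of these factors, by multilinearity. *)
Lemma perms_avg_mixture_le d (J : finType) (v : J -> 'I_N -> ('I_d -> {perm 'I_N}) -> R)
    (m : J -> R) (c : 'I_N -> J -> R) (C : R) :
  (forall n j, 0 <= c n j) ->
  (forall l : 'I_N -> J,
     perms_avg (fun s => \prod_n v (l n) n s) <= C * \prod_n m (l n)) ->
  perms_avg (fun s => \prod_n \sum_j c n j * v j n s) <=
  C * \prod_n \sum_j c n j * m j.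
Proof.
move=> c0 le; rewrite bigA_distr_bigA mulr_sumr.
rewrite (eq_perms_avg (F2 := fun s => \sum_(l : {ffun 'I_N -> J})
    ((\prod_n c n (l n)) * \prod_n v (l n) n s))); last first.
  by move=> s; rewrite bigA_distr_bigA; apply: eq_bigr => l _; rewrite big_split.
rewrite perms_avg_sum; apply: ler_sum => l _.
by rewrite perms_avgZ big_split/= [leRHS]mulrCA ler_wpM2l// prodr_ge0.
Qed.

Lemma sum_option_bool (F : option bool -> R) :
  \sum_l F l = F None + F (Some false) + F (Some true).
Proof.
rewrite (bigD1 None)//= (bigD1 (Some false))//= (bigD1 (Some true))//= big1.
  by rewrite addr0 addrA.
by case=> [[]|].
Qed.

Definition cells_below d (c : 'I_d -> R) (s : 'I_d -> {perm 'I_N}) (n : 'I_N) : R :=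
  \prod_j cell_below N (c j) (s j n).

Lemma perms_avg_cst d (c : R) : perms_avg (fun _ : 'I_d -> {perm 'I_N} => c) = c.
Proof.
elim: d => [|d IH]; first by rewrite (perms_avg0 _ (fun=> 1%g)).
by rewrite perms_avgS (eq_perm_avg (F2 := fun=> c)) ?perm_avg_cst.
Qed.

Lemma perms_avg_cells_below d (c : 'I_d -> R) (n : 'I_N) :
  (forall j, 0 <= c j <= 1) ->
  perms_avg (fun s => cells_below c s n) = \prod_j c j.
Proof.
elim: d c => [|d IH] c c01.
  by rewrite (perms_avg0 _ (fun=> 1%g)) /cells_below !big_ord0.
have N0 : (0 < N)%N by apply: leq_ltn_trans (ltn_ord n).
rewrite perms_avgS (eq_perm_avg (F2 := fun p =>
    (\prod_j c (lift ord0 j)) * cell_below N (c ord0) (p n))).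
  by rewrite perm_avgZ (perm_avg_at n (fun m => cell_below N (c ord0) m))
    cell_mean_below// big_ord_recl mulrC.
move=> p; rewrite -(IH (c \o lift ord0)); last by move=> j; exact: c01.
rewrite mulrC -perms_avgZ; apply: eq_perms_avg => s.
rewrite /cells_below big_ord_recl fun_cons0; congr (_ * _).
by apply: eq_bigr => j _; rewrite fun_consS.
Qed.

Lemma perms_avg_complement_if d k (F : ('I_d -> {perm 'I_N}) -> R) :
  perms_avg (fun s => complement_if k (F s)) = complement_if k (perms_avg F).
Proof. by case: k => //=; rewrite perms_avgB perms_avg_cst. Qed.

Lemma prod_le_bounds d (a b : 'I_d -> R) (A B : R) :
  (forall j, 0 <= a j) -> (forall j, a j <= b j) -> (forall j, b j <= 1) ->
  0 <= A -> A <= B -> B <= 1 ->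
  [/\ 0 <= \prod_j a j * A, \prod_j a j * A <= \prod_j b j * B
     & \prod_j b j * B <= 1].
Proof.
move=> a0 ab b1 A0 AB B1; have b0 j : 0 <= b j by rewrite (le_trans (a0 j)).
have pa0 : 0 <= \prod_j a j by rewrite prodr_ge0.
split; first by rewrite mulr_ge0.
  by rewrite ler_pM// ler_prod// => j _; rewrite a0 ab.
rewrite mulr_ile1 ?prodr_ge0// ?(le_trans A0)//.
by apply: prodr_ile1 => j _; rewrite b0 b1.
Qed.

(** Induction on the dimension. For a fixed first permutation, each factor is a
    nonnegative combination of the constant [1] and of the two
    functions of the remaining permutations, so the induction hypothesis
    applies through [perms_avg_mixture_le]. It replaces these functions by their
    means, and [coordinate_le] then averages over the first permutation. *)
Lemma labelled_perms_avg_le d k (a b C : 'I_d -> R) A B (lab : 'I_N -> option bool) :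
  (0 < N)%N ->
  (forall j, 0 <= a j) -> (forall j, a j <= b j) -> (forall j, b j <= 1) ->
  0 <= A -> A <= B -> B <= 1 ->
  (forall j, 1 <= C j) ->
  (forall j, (grid1 N (b j) \/ a j = 0) \/ expR 1 <= C j) ->
  perms_avg (fun s => \prod_n labelled 1
    (complement_if k (cells_below b s n * B))
    (complement_if k (cells_below b s n * B - cells_below a s n * A)) (lab n))
  <= \prod_j C j * \prod_n labelled 1
    (complement_if k (\prod_j b j * B))
    (complement_if k (\prod_j b j * B - \prod_j a j * A)) (lab n).
Proof.
move=> N0; elim: d a b C lab => [|d IH] a b C lab a0 ab b1 A0 AB B1 C1 hC.
  rewrite (perms_avg0 _ (fun=> 1%g)) !big_ord0 mul1r.
  by under eq_bigr do rewrite /cells_below !big_ord0.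
pose B' := \prod_(j < d) b (lift ord0 j) * B.
pose A' := \prod_(j < d) a (lift ord0 j) * A.
have [A'0 A'B' B'1] : [/\ 0 <= A', A' <= B' & B' <= 1] by exact: prod_le_bounds.
have cellsS c p (s : 'I_d -> _) n : cells_below c (fun_cons p s) n =
    cell_below N (c ord0) (p n) * cells_below (c \o lift ord0) s n.
  rewrite /cells_below big_ord_recl fun_cons0; congr (_ * _).
  by apply: eq_bigr => j _; rewrite fun_consS.
have C'0 : 0 <= \prod_(j < d) C (lift ord0 j).
  by apply: prodr_ge0 => j _; rewrite (le_trans ler01).
rewrite perms_avgS; pose bc n (p : {perm 'I_N}) := cell_below N (b ord0) (p n).
pose ac n (p : {perm 'I_N}) := cell_below N (a ord0) (p n).
apply: (@le_trans _ _ (perm_avg (fun p => \prod_(j < d) C (lift ord0 j) *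
    \prod_n labelled 1 (complement_if k (bc n p * B'))
       (complement_if k (bc n p * B' - ac n p * A')) (lab n)))); last first.
  rewrite perm_avgZ !big_ord_recl -!mulrA -/B' -/A' [leRHS]mulrCA ler_wpM2l//.
  exact: coordinate_le.
apply: le_perm_avg => p.
(* A point beyond b contributes the constant k; a point between a and b only
   needs the rest in B'; a point below a needs it in B' \ A'. *)
pose coef n (l : option bool) : R := match lab n with
  | None => (l == None)%:R
  | Some lb => match l with
    | None => k%:R * (1 - bc n p)
    | Some false => if lb then bc n p - ac n p else bc n p
    | Some true => if lb then ac n p else 0
    end
  end.
have coefE n (x y : R) : labelled 1 (complement_if k (bc n p * x))
     (complement_if k (bc n p * x - ac n p * y)) (lab n) =
    \sum_l coef n l * labelled 1 (complement_if k x) (complement_if k (x - y)) l.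
  rewrite sum_option_bool /coef; case: (lab n) => [[]|] /=; case: (k) => /=; ring.
under [X in _ <= _ * X]eq_bigr => n _ do rewrite coefE.
rewrite (eq_perms_avg (F2 := fun s => \prod_n \sum_l coef n l *
    labelled 1 (complement_if k (cells_below (b \o lift ord0) s n * B))
     (complement_if k (cells_below (b \o lift ord0) s n * B -
        cells_below (a \o lift ord0) s n * A)) l)); last first.
  by move=> s; apply: eq_bigr => n _; rewrite -coefE !cellsS !mulrA.
apply: (perms_avg_mixture_le (v := fun l n s =>
    labelled 1 (complement_if k (cells_below (b \o lift ord0) s n * B))
     (complement_if k (cells_below (b \o lift ord0) s n * B -
        cells_below (a \o lift ord0) s n * A)) l)).
  move=> n l; have := cell_below_ge0 N (a ord0) (p n).
  have := cell_below_le1 N (b ord0) (p n); have := @cell_below_le _ N _ _ (p n) (ab ord0).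
  rewrite /coef -/(bc n p) -/(ac n p); case: (lab n) => [[]|]; case: l => [[]|]; case: (k) => /=; lra.
by move=> l; apply: IH => // j; [exact: a0|exact: ab|exact: b1|exact: hC].
Qed.

End Dimensions.

Local Open Scope classical_set_scope.
Local Open Scope ring_scope.

(** * The law of the sample on boxes and their differences *)

Section Law.
Context {dO : measure_display} {Omega : measurableType dO} {R : realType}.
Variable P : probability Omega R.

Lemma measurable_below (c : R) : measurable [set u : R | u < c].
Proof.
rewrite (_ : [set u | u < c] = `]-oo, c[%classic); first exact: measurable_itv.
by apply/seteqP; split=> u /=; rewrite in_itv.
Qed.

Lemma measurable_forall (I : finType) (E : I -> set Omega) :
  (forall i, measurable (E i)) -> measurable [set w | forall i, E i w].
Proof.
move=> mE; rewrite (_ : [set w | _] = \bigcap_(i in setT) E i).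
  by apply: fin_bigcap_measurable.
by apply/seteqP; split=> w /= h i; [move=> _|]; exact: h.
Qed.

Lemma measure_fiberwise (T : finType) (f : Omega -> T) (A : set Omega) :
  measurable A -> (forall t, measurable (f @^-1` [set t])) ->
  P A = (\sum_t P (A `&` f @^-1` [set t]))%E.
Proof.
move=> mA mf; rewrite fsbig_seq ?index_enum_uniq//.
rewrite -measure_fin_bigcup//.
- congr (P _); apply/seteqP; split=> [w Aw|w [t _ []]//].
  by exists (f w) => //=; rewrite mem_index_enum.
- by move=> t t' _ _ [w [[_ <-] [_ <-]]].
- by move=> t _; exact: measurableI.
Qed.

(** A point whose permutation sends it to the cell [m] has coordinate
    [(m + u) / N], which is below [c] iff [u < N * c - m]. *)
Lemma uniform01_below N (U : Omega -> R) (c : R) (m : nat) :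
  uniform01 P U ->
  P (U @^-1` [set u | u < N%:R * c - m%:R]) = (cell_below N c m)%:E.
Proof.
case=> mU U01 PU; case: cell_belowP => [full|empty|/andP[lo hi]].
- rewrite (_ : _ @^-1` _ = setT) ?probability_setT//.
  apply/seteqP; split=> w //= _; have /andP[_ lt1] := U01 w.
  by rewrite (lt_le_trans lt1)// lerBrDl natr1.
- rewrite (_ : _ @^-1` _ = set0) ?measure0//.
  apply/seteqP; split=> w //=; have /andP[ge0 _] := U01 w.
  by rewrite ltNge (le_trans _ ge0)// subr_le0.
- set t := _ - _; have t01 : 0 < t < 1 by rewrite /t subr_gt0 lo ltrBlDl natr1.
  rewrite (_ : [set u | u < t] = `]-oo, t[%classic)// PU//.
  rewrite /uniform_prob integral_uniform_pdf.
  rewrite (_ : _ `&` _ = `[0, t[%classic); last first.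
    apply/seteqP; split=> u /=; rewrite !in_itv/=; first by move=> [-> /andP[->]].
    by move=> /andP[-> ut]; rewrite ut (ltW (lt_trans ut _))//; case/andP: t01.
  rewrite (eq_integral (fun=> 1%:E)); last first.
    move=> u; rewrite inE/= in_itv/= => /andP[u0 ut]; rewrite /uniform_pdf u0.
    by rewrite (ltW (lt_trans ut _)) ?subr0 ?invr1//; case/andP: t01.
  rewrite integral_cst//= mul1e lebesgue_measure_itv/= lte_fin.
  by case/andP: t01 => -> _; rewrite oppr0 adde0.
Qed.

(** Conditioning on all the permutations turns the event into a product of
    independent constraints on the [U n j]. *)
Lemma latin_hypercube_below N k (X : 'I_N -> Omega -> k.-tuple R)
    (c : 'I_N -> 'I_k -> R) : (0 < N)%N ->
  latin_hypercube_sample P X ->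
  P [set w | forall n j, tnth (X n w) j < c n j] =
  (perms_avg (fun s : 'I_k -> {perm 'I_N} =>
     \prod_n \prod_j cell_below N (c n j) (s j n)))%:E.
Proof.
move=> N0 [p [U [pU UU [mF indep] XE]]].
have mp j t : measurable (p j @^-1` [set t]) by case: (pU j t).
have mU n j c' : measurable (U n j @^-1` [set u | u < c']).
  case: (UU n j) => mUnj _ _; rewrite -[X in measurable X]setTI; apply: mUnj => //.
  exact: measurable_below.
pose f w : {ffun 'I_k -> {perm 'I_N}} := [ffun j => p j w].
have fE s : f @^-1` [set s] = [set w | forall j, (p j @^-1` [set s j]) w].
  apply/seteqP; split=> w /= => [<- j|h]; first by rewrite ffunE.
  by apply/ffunP => j; rewrite ffunE h.
have mf s : measurable (f @^-1` [set s]).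
  by rewrite fE; apply: measurable_forall.
pose Ev (s : {ffun 'I_k -> {perm 'I_N}}) (i : 'I_k + 'I_N * 'I_k) : set Omega :=
  match i with
  | inl j => p j @^-1` [set s j]
  | inr nj => U nj.1 nj.2 @^-1`
      [set u | u < N%:R * c nj.1 nj.2 - (s nj.2 nj.1 : nat)%:R]
  end.
set A := [set w | _].
have AE s : A `&` f @^-1` [set s] =
    \bigcap_(i in [set` [set: 'I_k + 'I_N * 'I_k]%SET]) Ev s i.
  have NR : 0 < N%:R :> R by rewrite ltr0n.
  have key n j w : p j w = s j -> (tnth (X n w) j < c n j) =
      (U n j w < N%:R * c n j - (s j n : nat)%:R).
    by move=> pjs; rewrite XE pjs ltr_pdivrMr// ltrBrDl mulrC.
  rewrite fE; apply/seteqP; split=> [w [Aw fw] [j|[n j]] _ /=|w h].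
  - exact: fw.
  - by rewrite -(key _ _ _ (fw j)); exact: Aw.
  - have fw j : p j w = s j by apply: (h (inl j)); rewrite /= finset.in_setT.
    split=> // n j; rewrite (key _ _ _ (fw j)).
    by have := h (inr (n, j)); apply; rewrite /= finset.in_setT.
have mEv s i : measurable (Ev s i) by case: i => [j|[n j]] /=.
have mAf s : measurable (A `&` f @^-1` [set s]).
  by rewrite AE; apply: fin_bigcap_measurable.
have mA : measurable A.
  rewrite (_ : A = \bigcup_(s in setT) (A `&` f @^-1` [set s])).
    by apply: fin_bigcup_measurable => [|s _]; [exact: finite_finset|exact: mAf].
  by apply/seteqP; split=> [w Aw|w [s _ []]//]; exists (f w).
rewrite (measure_fiberwise mA mf) /perms_avg mulr_sumr -sumEFin.
apply: eq_bigr => s _; rewrite AE indep; last first.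
  move=> [j|[n j]] _ /=.
    by exists [set s j] => //; rewrite setTI.
  exists [set u | u < N%:R * c n j - (s j n : nat)%:R]; last by rewrite setTI.
  exact: measurable_below.
rewrite [LHS](eq_bigl xpredT); last by move=> i; rewrite finset.in_setT.
rewrite big_sumType/= EFinM; congr (_ * _)%E.
  rewrite (eq_bigr (fun=> (N`!%:R^-1)%:E)); last by move=> j _; case: (pU j (s j)).
  by rewrite prodEFin prodr_const card_ord.
rewrite (eq_bigr (fun nj : 'I_N * 'I_k => (cell_below N (c nj.1 nj.2) (s nj.2 nj.1))%:E)).
  by rewrite prodEFin pair_big.
by move=> [n j] _ /=; exact: uniform01_below.
Qed.
End Law.

Section Measurability.
Context {R : realType}.

Lemma measurable_tnth_below n (j : 'I_n) (c : R) :
  measurable [set t : n.-tuple R | tnth t j < c].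
Proof.
rewrite -[X in measurable X]setTI.
exact: (measurable_tnth (T := R) j) (measurable_below c).
Qed.

Lemma measurable_box n (x y : n.-tuple R) : measurable (box x y).
Proof.
apply: measurable_forall => j.
rewrite -[X in measurable X]setTI.
apply: (measurable_tnth (T := R) j _ (Y := [set u | tnth x j <= u < tnth y j])) => //.
rewrite (_ : [set u | _] = `[tnth x j, tnth y j[%classic); first exact: measurable_itv.
by apply/seteqP; split=> u /=; rewrite in_itv.
Qed.

End Measurability.

Section JointLaw.
Context {dO : measure_display} {Omega : measurableType dO} {R : realType}.
Variables (P : probability Omega R) (N d' d'' : nat).
Hypothesis N_gt0 : (0 < N)%N.
Variables (X : 'I_N -> Omega -> d'.-tuple R) (Y : 'I_N -> Omega -> d''.-tuple R).
Hypotheses (hX : latin_hypercube_sample P X) (hY : monte_carlo P Y).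
Hypothesis hXY : independent_pair P (fun w => [tuple X n w | n < N])
                                    (fun w => [tuple Y n w | n < N]).

Let Z (n : 'I_N) (w : Omega) := cat_tuple (X n w) (Y n w).

Lemma latin_hypercube_cube n w : cube (X n w).
Proof.
case: hX => p [U [_ UU _ XE]] j; rewrite XE.
have NR : 0 < N%:R :> R by rewrite ltr0n.
case: (UU n j) => _ /(_ w)/andP[U0 U1] _.
rewrite divr_ge0 ?addr_ge0//= ltr_pdivrMr// mul1r.
have : (p j w n)%:R + 1 <= N%:R :> R by rewrite natr1 ler_nat.
lra.
Qed.

Lemma measurable_latin n : measurable_fun setT (X n).
Proof.
apply/measurable_fun_tnthP => j.
case: hX => p [U [pU UU _ XE]].
rewrite (_ : _ \o _ = fun w => ((p j w n : nat)%:R + U n j w) / N%:R); last first.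
  by apply/funext => w /=; rewrite XE.
apply: measurable_realfun.measurable_funM => //.
apply: measurable_realfun.measurable_funD; last by case: (UU n j).
move=> _ S mS; rewrite setTI.
rewrite (_ : _ @^-1` S =
    \bigcup_(s in [set s : {perm 'I_N} | S (s n : nat)%:R]) (p j @^-1` [set s])).
  by apply: fin_bigcup_measurable => [|s _]; [exact: finite_finset|case: (pU j s)].
by apply/seteqP; split=> [w Sw|w [s Ss /= ->]//]; exists (p j w).
Qed.

Lemma measurable_Z n : measurable_fun setT (Z n).
Proof.
apply/measurable_fun_tnthP => i.
case: (split_ordP i) => j ->.
  rewrite (_ : _ \o _ = (@tnth _ R ^~ j) \o X n).
    exact: measurableT_comp (measurable_tnth j) (measurable_latin n).
  by apply/funext => w; rewrite /= tnth_lshift.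
rewrite (_ : _ \o _ = (@tnth _ R ^~ j) \o Y n).
  by apply: measurableT_comp (measurable_tnth j) _; case: hY => /(_ n)[].
by apply/funext => w; rewrite /= tnth_rshift.
Qed.

Lemma cube_Z n w : cube (Z n w).
Proof.
move=> i; case: (split_ordP i) => j ->.
  by rewrite tnth_lshift; exact: latin_hypercube_cube.
by rewrite tnth_rshift; case: hY => /(_ n)[_ + _] _; apply.
Qed.

Definition box_share (c : (d' + d'').-tuple R) (s : 'I_d' -> {perm 'I_N}) (n : 'I_N) : R :=
  cells_below (fun j => tnth c (lshift d'' j)) s n * \prod_j tnth c (rshift d' j).

Lemma joint_anchored_boxes (c : 'I_N -> (d' + d'').-tuple R) :
  (forall n, closed_cube (c n)) ->
  P [set w | forall n, anchored_box (c n) (Z n w)] =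
  (perms_avg (fun s => \prod_n box_share (c n) s n))%:E.
Proof.
move=> c01.
pose cX n j := tnth (c n) (lshift d'' j).
pose cY n : d''.-tuple R := [tuple tnth (c n) (rshift d' j) | j < d''].
pose EX := [set w | forall n j, tnth (X n w) j < cX n j].
pose EY := [set w | forall n, anchored_box (cY n) (Y n w)].
have -> : [set w | forall n, anchored_box (c n) (Z n w)] =
    \bigcap_(b in [set` [set: bool]%SET]) (if b then EX else EY).
  apply/seteqP; split=> w h.
    move=> [] _ n => [j|j]; first by have := h n (lshift d'' j); rewrite tnth_lshift => /andP[].
    by have := h n (rshift d' j); rewrite tnth_rshift !tnth_mktuple.
  have hEX : EX w by apply: (h true); rewrite /= finset.in_setT.
  have hEY : EY w by apply: (h false); rewrite /= finset.in_setT.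
  move=> n i; rewrite tnth_mktuple; case: (split_ordP i) => j ->.
    rewrite tnth_lshift hEX andbT.
    by have /andP[] := latin_hypercube_cube n w j.
  by have := hEY n j; rewrite !tnth_mktuple tnth_rshift.
case: hXY => _ -> ; last first.
  move=> [] _.
    exists [set t : N.-tuple (d'.-tuple R) | forall n j, tnth (tnth t n) j < cX n j].
      apply: measurable_forall => n; apply: measurable_forall => j.
      rewrite -[X in measurable X]setTI.
      exact: (measurable_tnth (T := d'.-tuple R) n) (measurable_tnth_below j (cX n j)).
    rewrite setTI; apply/seteqP; split=> w h n j; have := h n j; by rewrite tnth_mktuple.
  exists [set t : N.-tuple (d''.-tuple R) | forall n, anchored_box (cY n) (tnth t n)].
    apply: measurable_forall => n.
    rewrite -[X in measurable X]setTI.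
    exact: (measurable_tnth (T := d''.-tuple R) n) (measurable_box _ (cY n)).
  rewrite setTI; apply/seteqP; split=> w h n; have := h n; by rewrite tnth_mktuple.
rewrite (eq_bigl xpredT); last by move=> b; rewrite finset.in_setT.
rewrite big_bool/= (latin_hypercube_below cX N_gt0 hX).
case: hY => Yunif [_ Yindep].
have -> : EY = \bigcap_(n in [set` [set: 'I_N]%SET]) (Y n @^-1` anchored_box (cY n)).
  apply/seteqP; split=> w h n; first by move=> _; exact: h.
  by apply: h; rewrite /= finset.in_setT.
rewrite Yindep; last first.
  by move=> n _; exists (anchored_box (cY n)); [exact: measurable_box|rewrite setTI].
rewrite [X in (_ * X)%E](eq_bigl xpredT); last by move=> n; rewrite finset.in_setT.
rewrite (eq_bigr (fun n => (\prod_j tnth (c n) (rshift d' j))%:E)); last first.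
  move=> n _; case: (Yunif n) => _ _ ->.
  - by congr EFin; apply: eq_bigr => j _; rewrite !tnth_mktuple subr0.
  - by move=> j; rewrite tnth_mktuple lexx ler01.
  - by move=> j; rewrite tnth_mktuple; exact: c01.
  - by move=> j; rewrite !tnth_mktuple; have /andP[] := c01 n (rshift d' j).
rewrite prodEFin -EFinM; congr EFin; rewrite mulrC -perms_avgZ.
by apply: eq_perms_avg => s; rewrite mulrC -big_split.
Qed.

(** The sets reached from anchored boxes by proper differences, each paired with
    the conditional probability, given that the permutations are [s], that the
    point [n] lies in it. *)
Inductive difference_closure (n : 'I_N) :
    set ((d' + d'').-tuple R) -> (('I_d' -> {perm 'I_N}) -> R) -> Prop :=
  | ClosureBox c of closed_cube c :
      difference_closure n (anchored_box c) (fun s => box_share c s n)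
  | ClosureDiff E F q r of difference_closure n E q & difference_closure n F r &
      F `<=` E : difference_closure n (E `\` F) (fun s => q s - r s).

Lemma difference_closure_measurable n E q :
  difference_closure n E q -> measurable E.
Proof.
by elim=> [c _|*]; [exact: measurable_box|exact: measurableD].
Qed.

Definition update (T : Type) (f : 'I_N -> T) (n : 'I_N) (x : T) (m : 'I_N) : T :=
  if m == n then x else f m.

Lemma update_id (T : Type) (f : 'I_N -> T) n : update f n (f n) = f.
Proof. by apply/funext => m; rewrite /update; case: eqP => [->|]. Qed.

Definition has_law (E : 'I_N -> set ((d' + d'').-tuple R))
    (q : 'I_N -> ('I_d' -> {perm 'I_N}) -> R) : Prop :=
  P [set w | forall n, E n (Z n w)] = (perms_avg (fun s => \prod_n q n s))%:E.

(** Multilinear extension: the law is known when all sets are anchored boxes, and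
    it passes to a proper difference in a single argument, the others being fixed,
    because both sides are additive. The arguments are treated one by one. *)
Lemma has_law_closure E q :
  (forall n, difference_closure n (E n) (q n)) -> has_law E q.
Proof.
suff gen (r : seq 'I_N) : forall E q, (forall n, difference_closure n (E n) (q n)) ->
    (forall n, n \notin r -> exists2 c, closed_cube c &
       E n = anchored_box c /\ q n = fun s => box_share c s n) ->
    has_law E q.
  move=> closed; apply: (gen (enum 'I_N)) => // n; by rewrite mem_enum.
elim: r => [|n r IH] {}E {}q closed base.
  have /choice[c hc] n : exists c, closed_cube c /\
      (E n = anchored_box c /\ q n = fun s => box_share c s n).
    by have [//|c c01 eqs] := base n; exists c.
  rewrite /has_law (_ : [set w | _] = [set w | forall n, anchored_box (c n) (Z n w)]).
    rewrite joint_anchored_boxes; last by move=> n; case: (hc n).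
    congr EFin; apply: eq_perms_avg => s; apply: eq_bigr => n _.
    by have [_ [_ ->]] := hc n.
  by apply/seteqP; split=> w h n; have := h n; have [_ [-> _]] := hc n.
rewrite -(update_id E n) -(update_id q n).
elim: (closed n) => [c c01|E1 E2 q1 q2 cl1 IH1 cl2 IH2 E21].
  apply: IH => m; rewrite /update; case: eqP => [->|/eqP mn].
  - exact: ClosureBox.
  - exact: closed.
  - by move=> _; exists c.
  - by move=> mr; apply: base; rewrite inE negb_or mn.
pose ev F := [set w | forall m, update E n F m (Z m w)].
have mev F f : difference_closure n F f -> measurable (ev F).
  move=> cl; apply: measurable_forall => m.
  rewrite -[X in measurable X]setTI; apply: measurable_Z => //.
  rewrite /update; case: eqP => [_|_]; first exact: difference_closure_measurable cl.
  exact: difference_closure_measurable (closed m).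
rewrite /has_law (_ : [set w | _] = ev E1 `\` ev E2); last first.
  apply/seteqP; split=> [w h|w [h1 h2] m].
    have [w1 w2] : (E1 `\` E2) (Z n w) by have := h n; rewrite /update eqxx.
    split=> [m|/(_ n)]; last by rewrite /update eqxx.
    by have := h m; rewrite /update; case: eqP => [->|//].
  have := h1 m; rewrite /update; case: eqP => [->|//] w1; split=> // w2.
  apply: h2 => k; have := h1 k; rewrite /update; by case: eqP => [->|].
have -> : P (ev E1 `\` ev E2) = (P (ev E1) - P (ev E2))%E.
  rewrite measureD; [|exact: mev cl1|exact: mev cl2|]; last first.
    by rewrite (le_lt_trans (probability_le1 _ (mev _ _ cl1))) ?ltry.
  congr (_ - P _)%E; apply: setIidr => w h m; have := h m.
  by rewrite /update; case: eqP => [->|//]; exact: E21.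
rewrite [P _]IH1 [P (ev E2)]IH2 -EFinB; congr EFin.
rewrite -perms_avgB; apply: eq_perms_avg => s.
rewrite [X in X - _](bigD1 n)//= [X in _ - X](bigD1 n)//= [RHS](bigD1 n)//= /update eqxx mulrBl.
by congr (_ * _ - _ * _); apply: eq_bigr => m /negbTE ->.
Qed.

Lemma closure_cube n : difference_closure n (@cube R (d' + d'')) (fun=> 1).
Proof.
pose ones : (d' + d'').-tuple R := [tuple 1 | _ < d' + d''].
have -> : @cube R (d' + d'') = anchored_box ones.
  by apply/seteqP; split=> z h i; have := h i; rewrite !tnth_mktuple.
have -> : (fun=> 1) = (fun s : 'I_d' -> {perm 'I_N} => box_share ones s n).
  apply/funext => s; rewrite /box_share /cells_below !big1 ?mulr1// => j _.
    by rewrite tnth_mktuple.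
  by rewrite tnth_mktuple cell_below_full// mulr1 ler_nat.
by apply: ClosureBox => i; rewrite tnth_mktuple lexx ler01.
Qed.

Lemma anchored_box_subset_cube (b : (d' + d'').-tuple R) :
  closed_cube b -> anchored_box b `<=` @cube R (d' + d'').
Proof.
move=> b01 z bz i; have /andP[_ b1] := b01 i; have := bz i.
by rewrite tnth_mktuple => /andP[-> /lt_le_trans ->].
Qed.

(** * Negative dependence of the indicators of box differences *)

Section BoxDifference.
Variables (l : bool) (a b : (d' + d'').-tuple R) (C : 'I_d' -> R).
Hypotheses (ha : closed_cube a) (hb : closed_cube b).
Hypothesis hab : forall i, tnth a i <= tnth b i.
Hypothesis C1 : forall j, 1 <= C j.
Hypothesis hC : forall j, (grid1 N (tnth b (lshift d'' j)) \/
  tnth a (lshift d'' j) = 0) \/ expR 1 <= C j.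

Let S : set ((d' + d'').-tuple R) :=
  if l then anchored_box b `\` anchored_box a else anchored_box b.

Let aL j := tnth a (lshift d'' j).
Let bL j := tnth b (lshift d'' j).
Let A := \prod_j tnth a (rshift d' j).
Let B := \prod_j tnth b (rshift d' j).

Let label (u : {set 'I_N}) n := if n \in u then Some l else None.

Let closure_S n : difference_closure n S (fun s =>
  if l then cells_below bL s n * B - cells_below aL s n * A
  else cells_below bL s n * B).
Proof.
have cl c : closed_cube c -> difference_closure n (anchored_box c) (fun s => box_share c s n).
  by move=> ?; exact: ClosureBox.
rewrite /S; case: l; last exact: cl.
apply: ClosureDiff; [exact: cl|exact: cl|].
by move=> z az i; have /andP[-> /lt_le_trans ->] := az i.
Qed.

Let event (k : bool) (u : {set 'I_N}) : set Omega :=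
  [set w | forall n, n \in u -> \1_S (Z n w) = (~~ k)%:R :> R].

Let share k (s : 'I_d' -> {perm 'I_N}) (n : 'I_N) := labelled 1
    (complement_if k (cells_below bL s n * B))
    (complement_if k (cells_below bL s n * B - cells_below aL s n * A)).

(** Indices outside [u] are left free, which is the constraint to lie in the
    cube. *)
Lemma event_law k u :
  P (event k u) = (perms_avg (fun s => \prod_n share k s n (label u n)))%:E.
Proof.
pose E n := if n \in u then (if k then @cube R _ `\` S else S) else @cube R _.
have S_cube : S `<=` @cube R _.
  rewrite /S; case: l => [z [+ _]|]; exact: anchored_box_subset_cube.
have -> : event k u = [set w | forall n, E n (Z n w)].
  apply/seteqP; split=> w h n; have := h n; rewrite /E; case: (n \in u) => //.
  - move=> /(_ isT); rewrite indicE; case: (k) => /=.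
      move=> /eqP; rewrite pnatr_eq0 eqb0 notin_setE => nS; split=> //; exact: cube_Z.
    by case: (boolP (_ \in S)) => [/set_mem//|_] /eqP; rewrite eq_sym oner_eq0.
  - by move=> _; exact: cube_Z.
  - case: (k) => [[_ nS]|inS] _; rewrite indicE /=.
      by rewrite memNset.
    by rewrite mem_set.
apply: has_law_closure => n; rewrite /E /share /label; case: (n \in u) => /=; last first.
  exact: closure_cube.
case: (k); last by have := closure_S n; case: (l).
have := ClosureDiff (closure_cube n) (closure_S n) S_cube.
by case: (l).
Qed.

Let volume k := complement_if k
  (if l then \prod_j bL j * B - \prod_j aL j * A else \prod_j bL j * B).

Lemma event1_law k n : P (event k [set n]%SET) = (volume k)%:E.
Proof.
rewrite event_law; congr EFin.
rewrite (eq_perms_avg (F2 := fun s => complement_if k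
  (if l then cells_below bL s n * B - cells_below aL s n * A
   else cells_below bL s n * B))); last first.
  move=> s; rewrite (bigD1 n)//= big1 ?mulr1.
    by rewrite /share /label inE eqxx /=; case: l.
  by move=> m mn; rewrite /share /label inE (negbTE mn).
rewrite perms_avg_complement_if /volume; congr complement_if.
have avgZ c (x : R) : (forall j, 0 <= c j <= 1) ->
    perms_avg (fun s : 'I_d' -> {perm 'I_N} => cells_below c s n * x) = \prod_j c j * x.
  move=> c01; rewrite -(perms_avg_cells_below n c01) mulrC -perms_avgZ.
  by apply: eq_perms_avg => s; rewrite mulrC.
case: l; rewrite ?perms_avgB !avgZ// => j; first [exact: hb|exact: ha].
Qed.

Lemma event_le k u :
  (P (event k u) <= (\prod_j C j)%:E * \prod_(n in u) P (event k [set n]%SET))%E.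
Proof.
rewrite event_law [X in (_ * X)%E](eq_bigr (fun=> (volume k)%:E)); last first.
  by move=> n _; exact: event1_law.
rewrite prodEFin -EFinM lee_fin.
have bounds (r : 'I_d'' -> 'I_(d' + d'')) :
    [/\ 0 <= \prod_j tnth a (r j), \prod_j tnth a (r j) <= \prod_j tnth b (r j)
     & \prod_j tnth b (r j) <= 1].
  have := @prod_le_bounds R d'' (fun j => tnth a (r j)) (fun j => tnth b (r j)) 1 1.
  rewrite !mulr1; apply=> // j; [by have /andP[] := ha (r j)|by have /andP[] := hb (r j)].
have [A0 AB B1] := bounds (@rshift d' d'').
have := @labelled_perms_avg_le R N d' k aL bL C A B (label u) N_gt0.
rewrite (_ : \prod_n labelled 1 _ _ (label u n) = \prod_(n in u) volume k); last first.
  rewrite [RHS]big_mkcond; apply: eq_bigr => n _; rewrite /label /volume.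
  by case: (n \in u) => //=; case: l.
apply=> // j; [|exact: hab|].
  by have /andP[] := ha (lshift d'' j).
by have /andP[] := hb (lshift d'' j).
Qed.

(** The flag [l] selects [B \ A] or the box [B] itself. The latter is not an
    instance of the former: in dimension zero every anchored box is a point, and
    no difference of boxes equals [B]. *)
Lemma neg_dependent_box_difference :
  neg_dependent P (\prod_j C j) (fun n w => \1_S (Z n w)).
Proof.
have mS : measurable S.
  by rewrite /S; case: l; [apply: measurableD|]; exact: measurable_box.
split.
- by elim/big_ind: _ => // x y x1 y1; rewrite mulr_ege1.
- by move=> n; apply: measurableT_comp (measurable_Z n); exact: measurable_realfun.measurable_indic.
- by move=> n w; rewrite indicE; case: (_ \in _); [right|left].
- have single k n : [set w | \1_S (Z n w) = (~~ k)%:R :> R] = event k [set n]%SET.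
    apply/seteqP; split=> w /= h; first by move=> m; rewrite inE => /eqP ->.
    by apply: h; rewrite inE.
  move=> u; split.
    have := event_le false u; under [X in (_ <= _ * X)%E]eq_bigr do rewrite -single.
    by [].
  have := event_le true u; under [X in (_ <= _ * X)%E]eq_bigr do rewrite -single.
  by [].
Qed.

End BoxDifference.

End JointLaw.

Section Boxes.
Context {R : realType}.

Definition tuple_min n (a b : n.-tuple R) : n.-tuple R :=
  [tuple Num.min (tnth a i) (tnth b i) | i < n].

Lemma anchored_boxD_min n (a b : n.-tuple R) :
  anchored_box b `\` anchored_box a = anchored_box b `\` anchored_box (tuple_min a b).
Proof.
apply/seteqP; split=> z [bz naz]; split=> // az; apply: naz => i;
  have := az i; have := bz i; rewrite !tnth_mktuple.
- by rewrite lt_min => _ /andP[-> /andP[-> _]].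
- by rewrite lt_min => /andP[-> ->] /andP[_ ->].
Qed.

Lemma closed_cube_tuple_min n (a b : n.-tuple R) :
  closed_cube a -> closed_cube b -> closed_cube (tuple_min a b).
Proof.
move=> ha hb i; have /andP[a0 a1] := ha i; have /andP[b0 _] := hb i.
by rewrite tnth_mktuple le_min a0 b0 ge_min a1.
Qed.

Lemma delta_ge1 N (x y : R) : 1 <= delta N x y.
Proof.
rewrite /delta; case: ifP => // _.
by rewrite (le_trans _ (expR_ge1Dx 1))// lerDl.
Qed.

(** The regular case of [delta] survives the replacement of [x] by
    [Num.min x y]. *)
Lemma delta_regular N (x y : R) : 0 <= y ->
  (grid1 N y \/ Num.min x y = 0) \/ expR 1 <= delta N x y.
Proof.
move=> y0; rewrite /delta; case: asboolP => [[[_ ?]|->]|_]; last by right.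
- by left; left.
- by left; right; rewrite min_l.
Qed.

End Boxes.

Theorem theorem3p6 (R : realType) (dO : measure_display)
    (Omega : measurableType dO) (P : probability Omega R)
    (N d' d'' : nat) (N_gt0 : (0 < N)%N)
    (X : 'I_N -> Omega -> d'.-tuple R) (Y : 'I_N -> Omega -> d''.-tuple R)
    (hX : latin_hypercube_sample P X) (hY : monte_carlo P Y)
    (hXY : independent_pair P (fun w => [tuple X n w | n < N])
                              (fun w => [tuple Y n w | n < N])) :
  let Z := fun (n : 'I_N) (w : Omega) => cat_tuple (X n w) (Y n w) in
  (forall a b : (d' + d'').-tuple R, cube a -> cube b ->
     let D := anchored_box b `\` anchored_box a in
     neg_dependent P (gamma_factor N a b) (fun n w => \1_D (Z n w))) /\
  neg_dependent_points P (@C0 R (d' + d'')) 1 Z /\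
  neg_dependent_points P (@D0 R (d' + d'')) (expR 1 ^+ d') Z.
Proof.
move=> Z.
have differences (a b : (d' + d'').-tuple R) (C : 'I_d' -> R) :
    closed_cube a -> closed_cube b -> (forall j, 1 <= C j) ->
    (forall j, delta N (tnth a (lshift d'' j)) (tnth b (lshift d'' j)) <= C j) ->
    neg_dependent P (\prod_j C j)
      (fun n w => \1_(anchored_box b `\` anchored_box a) (Z n w)).
  move=> ha hb C1 leC; rewrite anchored_boxD_min.
  apply: (neg_dependent_box_difference N_gt0 hX hY hXY true) => //.
  - exact: closed_cube_tuple_min.
  - by move=> i; rewrite tnth_mktuple ge_min lexx orbT.
  - move=> j; rewrite tnth_mktuple.
    have /andP[b0 _] := hb (lshift d'' j).
    have [reg|le] := delta_regular N (tnth a (lshift d'' j)) b0; first by left.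
    by right; exact: le_trans le (leC j).
have cube_closed (c : (d' + d'').-tuple R) : cube c -> closed_cube c.
  by move=> hc i; have /andP[-> /ltW ->] := hc i.
split; first by move=> a b ha hb; apply: differences; auto => j; exact: delta_ge1.
split; split; try by [exact: measurable_Z hX hY|exact: cube_Z hX hY].
- move=> _ [b hb <-].
  (* With a = 0 the constant 1 is admissible in every coordinate. *)
  pose o : (d' + d'').-tuple R := [tuple 0 | _ < d' + d''].
  have -> : 1 = \prod_(j < d') 1 :> R by rewrite big1_eq.
  apply: (neg_dependent_box_difference N_gt0 hX hY hXY false (a := o)) => //.
  - by move=> i; rewrite tnth_mktuple lexx ler01.
  - by move=> i; rewrite tnth_mktuple; have /andP[] := hb i.
  - by move=> j; left; right; rewrite tnth_mktuple.
- move=> _ [_ [b hb <-] [_ [a ha <-] <-]].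
  rewrite -[d' in _ ^+ d']card_ord -prodr_const.
  have e1 : 1 <= expR 1 :> R by rewrite (le_trans _ (expR_ge1Dx 1))// lerDl.
  apply: differences => // j.
  by rewrite /delta; case: ifP.
Qed.
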